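(* Let $n\geqslant 2$. The following simplicial complexes are naturally isomorphic, via the identification of the vertex $(i,j)$ with the point $\alpha_{ij}$ for each ordered pair $(i,j)$ of distinct elements of $[n]$: $$\operatorname{DAG}_n=\operatorname{Stel}(A_{n-1}),\qquad \operatorname{DisDS}_n=\operatorname{BStel}(A_{n-1}).$$
   Context: $[n]=\{1,\ldots,n\}$ and $[n]^{(2)}=\{(i,j)\mid i,j\in[n],\ i\neq j\}$. A directed graph on the vertex set $[n]$ is identified with its edge set $E\subseteq[n]^{(2)}$. $\operatorname{DAG}_n$ is the simplicial complex on the vertex set $[n]^{(2)}$ whose simplices are the edge sets of directed graphs on $[n]$ without directed cycles. A directed graph is strongly connected if for any two vertices $i,j$ there is a directed path from $i$ to $j$. $\operatorname{DisDS}_n$ is the simplicial complex on the vertex set $[n]^{(2)}$ whose simplices are the edge sets of directed graphs on $[n]$ that are not strongly connected. Let $e_1,\ldots,e_n$ be the standard basis of $\mathbb{R}^n$, and $\alpha_{ij}=e_j-e_i$ for $(i,j)\in[n]^{(2)}$. The collection $A_{n-1}=\{\alpha_{ij}\mid(i,j)\in[n]^{(2)}\}$ lies in the hyperplane $\Pi=\{\sum x_i=0\}\cong\mathbb{R}^{n-1}$, and after scaling the norm it is regarded as a collection of points on the unit sphere $\mathbb{S}^{n-2}\subset\Pi$. For a finite collection $Z$ of indexed points of a unit sphere $\mathbb{S}^{d-1}$ in a Euclidean space (here $d=n-1$), $\operatorname{Stel}(Z)$ (respectively $\operatorname{BStel}(Z)$) is the simplicial complex on the index set of $Z$ whose simplices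 are the sets of indices of points lying in a single open hemisphere $\{x\in\mathbb{S}^{d-1}\mid\langle x,z\rangle>0\}$ (respectively in a single closed hemisphere $\{x\in\mathbb{S}^{d-1}\mid\langle x,z\rangle\geqslant0\}$), for some $z\in\mathbb{S}^{d-1}$. *)

(* Defs.v *)
From mathcomp Require Import all_boot all_order all_algebra.
From mathcomp Require Import boolp reals.

Set Implicit Arguments.
Unset Strict Implicit.
Unset Printing Implicit Defensive.

Import Order.TTheory GRing.Theory Num.Theory.
Local Open Scope ring_scope.

(* Neither the empty set nor the singletons are required to be faces: this
   keeps the constructions below total. *)
Record scomplex (V : finType) := SComplex {
  face : {set V} -> Prop;
  face_sub : forall S T : {set V}, S \subset T -> face T -> face S
}.

(* [n]^(2); the vertex set [n] = {1, ..., n} is rendered as 'I_n. *)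
Definition opair (n : nat) := {p : 'I_n * 'I_n | p.1 != p.2}.

Section Digraphs.
Variable n : nat.
Implicit Types E F : {set opair n}.

Definition arc E : rel 'I_n := fun i j => [exists e in E, val e == (i, j)].

(* No loops occur in E, so a directed cycle has length at least 2; cycles of
   length 2 do count. *)
Definition acyclic E : Prop := forall c : seq 'I_n, ucycle (arc E) c -> c = [::].

Definition strongly_connected E : Prop := forall i j, connect (arc E) i j.

Lemma sub_arc E F : E \subset F -> subrel (arc E) (arc F).
Proof.
move=> EF i j /existsP[e /andP[eE ee]].
by apply/existsP; exists e; rewrite (subsetP EF).
Qed.

Lemma acyclic_sub E F : E \subset F -> acyclic F -> acyclic E.
Proof.
move=> /sub_arc EF aF c /andP[cE cu]; apply: aF; rewrite /ucycle cu andbT.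
exact: sub_cycle cE.
Qed.

Lemma disconnected_sub E F :
  E \subset F -> ~ strongly_connected F -> ~ strongly_connected E.
Proof.
move=> /sub_arc EF nF sE; apply: nF => i j.
by apply: connect_sub (sE i j) => x y /EF; apply: connect1.
Qed.

Definition DAG : scomplex (opair n) := SComplex acyclic_sub.

Definition DisDS : scomplex (opair n) := SComplex disconnected_sub.

End Digraphs.

Section Sphere.
Variables (R : realType) (m : nat).

Definition dot (x y : 'rV[R]_m) : R := \sum_i x 0 i * y 0 i.

Definition enorm (x : 'rV[R]_m) : R := Num.sqrt (dot x x).

Lemma dotZ a b x y : dot (a *: x) (b *: y) = a * b * dot x y.
Proof.
by rewrite /dot mulr_sumr; apply: eq_bigr => i _; rewrite !mxE mulrACA.
Qed.

Lemma dotxx_ge0 x : 0 <= dot x x.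
Proof. by apply: sumr_ge0 => i _; rewrite -expr2 sqr_ge0. Qed.

Lemma dotxx_eq0 x : (dot x x == 0) = (x == 0).
Proof.
apply/idP/eqP => [|->]; last by rewrite /dot big1 // => i _; rewrite mxE mul0r.
rewrite psumr_eq0 => [/allP x0|i _]; last by rewrite -expr2 sqr_ge0.
apply/rowP => i; rewrite mxE; apply/eqP.
by have := x0 i (mem_index_enum i); rewrite mulf_eq0 orbb.
Qed.

Lemma enorm_eq0 x : (enorm x == 0) = (x == 0).
Proof. by rewrite sqrtr_eq0 -dotxx_eq0 eq_le dotxx_ge0 andbT. Qed.

(* A Euclidean space is a linear subspace W of R^m with the standard inner
   product. *)
Definition sphere (W : {vspace 'rV[R]_m}) :=
  {x : 'rV[R]_m | (x \in W) && (enorm x == 1)}.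

Lemma normalize_subproof (W : {vspace 'rV[R]_m}) (x : 'rV[R]_m) :
  x \in W -> x != 0 ->
  ((enorm x)^-1 *: x \in W) && (enorm ((enorm x)^-1 *: x) == 1).
Proof.
move=> xW x0; rewrite memvZ //=; set a := enorm x.
have a0 : a != 0 by rewrite enorm_eq0.
rewrite /enorm dotZ -(sqr_sqrtr (dotxx_ge0 x)) -/(enorm x) -/a.
by rewrite -expr2 -exprMn mulVf // expr1n sqrtr1.
Qed.

Definition normalize (W : {vspace 'rV[R]_m}) (x : 'rV[R]_m)
    (xW : x \in W) (x0 : x != 0) : sphere W :=
  exist _ ((enorm x)^-1 *: x) (normalize_subproof xW x0).

Section Hemispheres.
Variables (W : {vspace 'rV[R]_m}) (I : finType) (Z : I -> sphere W).
Implicit Types S T : {set I}.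

Definition in_open_hemisphere S : Prop :=
  exists z : sphere W, forall i, i \in S -> 0 < dot (val (Z i)) (val z).

Definition in_closed_hemisphere S : Prop :=
  exists z : sphere W, forall i, i \in S -> 0 <= dot (val (Z i)) (val z).

Lemma in_open_hemisphere_sub S T :
  S \subset T -> in_open_hemisphere T -> in_open_hemisphere S.
Proof. by move=> /subsetP ST [z zT]; exists z => i /ST /zT. Qed.

Lemma in_closed_hemisphere_sub S T :
  S \subset T -> in_closed_hemisphere T -> in_closed_hemisphere S.
Proof. by move=> /subsetP ST [z zT]; exists z => i /ST /zT. Qed.

Definition Stel : scomplex I := SComplex in_open_hemisphere_sub.

Definition BStel : scomplex I := SComplex in_closed_hemisphere_sub.

End Hemispheres.
End Sphere.

Section Roots.
Variables (R : realType) (n : nat).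

(* The hyperplane of vectors with zero coordinate sum; see mem_hyperplane. *)
Definition hyperplane : {vspace 'rV[R]_n} :=
  lker (linfun (mulmxr (const_mx 1 : 'cV[R]_n)) : 'Hom('rV[R]_n, 'rV[R]_1)).

Lemma mem_hyperplane (x : 'rV[R]_n) : (x \in hyperplane) = (\sum_i x 0 i == 0).
Proof.
rewrite memv_ker lfunE /=.
have sumE k : (x *m const_mx 1 : 'rV[R]_1) 0 k = \sum_i x 0 i.
  by rewrite mxE; apply: eq_bigr => i _; rewrite mxE mulr1.
apply/eqP/eqP => [x0|x0]; first by rewrite -(sumE 0) x0 mxE.
by apply/rowP => k; rewrite sumE x0 mxE.
Qed.

Definition alpha (p : opair n) : 'rV[R]_n :=
  delta_mx 0 (val p).2 - delta_mx 0 (val p).1.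

Lemma alpha_hyperplane p : alpha p \in hyperplane.
Proof.
have sum_delta k : \sum_i (delta_mx 0 k : 'rV[R]_n) 0 i = 1.
  rewrite (bigD1 k) //= mxE !eqxx big1 ?addr0 // => i ik.
  by rewrite mxE (negPf ik).
rewrite mem_hyperplane; under eq_bigr do rewrite mxE [X in _ + X]mxE.
by rewrite sumrB !sum_delta subrr.
Qed.

Lemma alpha_neq0 p : alpha p != 0.
Proof.
apply/eqP => /rowP/(_ (val p).2); rewrite !mxE !eqxx.
rewrite eq_sym (negPf (valP p)) subr0 => /eqP.
by rewrite oner_eq0.
Qed.

(* The collection A_{n-1}, indexed by [n]^(2) and scaled to the unit sphere. *)
Definition A (p : opair n) : sphere hyperplane :=
  normalize (alpha_hyperplane p) (alpha_neq0 p).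

End Roots.

(* Main.v *)
(** A unit vector z of the hyperplane is, up to translation and positive
    scaling, a nonconstant function on the vertices, and the sign of its inner
    product with alpha_ij is that of z_j - z_i.  So Stel (resp. BStel) consists
    of the digraphs admitting a nonconstant function that strictly (resp.
    weakly) increases along arcs.  A strictly increasing function excludes
    directed cycles, and in an acyclic digraph the number of ancestors of a
    vertex is such a function.  A weakly increasing function is constant on a
    strongly connected digraph; if j is not reachable from i, the indicator
    function of the vertices reachable from i is weakly increasing and
    nonconstant. *)

From mathcomp Require Import all_boot all_order all_algebra.
From mathcomp Require Import boolp reals.
Require Import Defs.

Set Implicit Arguments.
Unset Strict Implicit.
Unset Printing Implicit Defensive.

Import Order.TTheory GRing.Theory Num.Theory.
Local Open Scope ring_scope.

(** Propositional extensionality identifies the two face predicates, and proof irrelevance the two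
    closure proofs. *)
Lemma scomplex_eq (V : finType) (K L : scomplex V) :
  (forall S, face K S <-> face L S) -> K = L.
Proof.
case: K L => [f fP] [g gP] /= fg.
have eq_fg : f = g by apply/funext => S; apply/propext.
by case: g / eq_fg gP {fg} => gP; congr SComplex; apply: Prop_irrelevance.
Qed.

Lemma arcP n (E : {set opair n}) i j :
  reflect (exists2 p, p \in E & val p = (i, j)) (arc E i j).
Proof. by apply: (iffP exists_inP) => -[p pE /eqP]; exists p. Qed.

Lemma arc_val n (E : {set opair n}) p :
  p \in E -> arc E (val p).1 (val p).2.
Proof. by move=> pE; apply/arcP; exists p => //; case: (val p). Qed.

Section Potentials.
Variables (d : Order.disp_t) (T : orderType d) (n : nat).
Implicit Types (E : {set opair n}) (f : 'I_n -> T).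

Lemma increasing_acyclic E f :
  (forall i j, arc E i j -> (f i < f j)%O) -> acyclic E.
Proof.
move=> fE [//|x c] /andP[cE _].
have /= := sub_cycle fE cE.
(* By transitivity [f x] lies below the value at every later vertex of the cycle, the last of which
   is [x] itself. *)
rewrite path_sortedE => [/andP[/allP/(_ x)]|y x' z]; last exact: lt_trans.
by rewrite mem_rcons mem_head ltxx => /(_ isT).
Qed.

Lemma nondecreasing_connect E f :
  (forall i j, arc E i j -> (f i <= f j)%O) ->
  forall i j, connect (arc E) i j -> (f i <= f j)%O.
Proof.
move=> fE i j /connectP[c]; elim: c i => [|k c IHc] i /= => [_ -> //|].
by move=> /andP[/fE ik ck] /(IHc _ ck); apply: le_trans.
Qed.

End Potentials.

(** A return path, shortened to be duplicate-free as [ucycle] demands, would close up with the arc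
    into a cycle. *)
Lemma acyclic_arc_not_connect n (E : {set opair n}) i j :
  acyclic E -> arc E i j -> ~~ connect (arc E) j i.
Proof.
move=> aE ij; apply/negP => /connectP[c cE ic].
case/shortenP: cE ic => c' c'E c'u _ ic.
suff /aE: ucycle (arc E) (j :: c') by [].
by rewrite /ucycle c'u andbT /= rcons_path c'E -ic.
Qed.

Definition ancestors n (E : {set opair n}) (i : 'I_n) :=
  [set k | connect (arc E) k i].

(** Ancestors pass along the arc, and [j] is an ancestor of itself but, by acyclicity, not of
    [i]. *)
Lemma ltn_card_ancestors n (E : {set opair n}) i j :
  acyclic E -> arc E i j -> (#|ancestors E i| < #|ancestors E j|)%N.
Proof.
move=> aE ij; apply: proper_card; apply/properP; split.
  apply/subsetP => k; rewrite !inE => ki.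
  exact: connect_trans ki (connect1 ij).
by exists j; rewrite inE ?connect0 // acyclic_arc_not_connect.
Qed.

Section Hemispheres.
Variables (R : realType) (n : nat).

Lemma dot_delta k (z : 'rV[R]_n) : dot (delta_mx 0 k) z = z 0 k.
Proof.
rewrite /dot (bigD1 k) //= mxE !eqxx mul1r big1 ?addr0 // => i ik.
by rewrite mxE (negPf ik) mul0r.
Qed.

Lemma dot_alpha p (z : 'rV[R]_n) :
  dot (alpha R p) z = z 0 (val p).2 - z 0 (val p).1.
Proof.
rewrite -!dot_delta /dot -sumrB; apply: eq_bigr => i _.
by rewrite -mulrBl !mxE.
Qed.

Lemma enorm_gt0 (x : 'rV[R]_n) : (0 < enorm x) = (x != 0).
Proof. by rewrite lt_def enorm_eq0 sqrtr_ge0 andbT. Qed.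

Lemma dot_A p (z : 'rV[R]_n) :
  dot (val (A R p)) z =
  (enorm (alpha R p))^-1 * (z 0 (val p).2 - z 0 (val p).1).
Proof. by rewrite -[z in LHS]scale1r dotZ mulr1 dot_alpha. Qed.

Lemma dot_A_ge0 p (z : 'rV[R]_n) :
  (0 <= dot (val (A R p)) z) = (z 0 (val p).1 <= z 0 (val p).2).
Proof. by rewrite dot_A pmulr_rge0 ?subr_ge0 // invr_gt0 enorm_gt0 alpha_neq0. Qed.

Lemma dot_A_gt0 p (z : 'rV[R]_n) :
  (0 < dot (val (A R p)) z) = (z 0 (val p).1 < z 0 (val p).2).
Proof. by rewrite dot_A pmulr_rgt0 ?subr_gt0 // invr_gt0 enorm_gt0 alpha_neq0. Qed.

(** A constant vector with zero coordinate sum vanishes, so it cannot have norm 1. *)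
Lemma sphere_hyperplane_nonconstant (z : sphere (hyperplane R n)) :
  exists i j, val z 0 i != val z 0 j.
Proof.
case: z => z /= /andP[]; rewrite mem_hyperplane => /eqP z0 z1.
apply: contrapT => zC.
have {}zC i j : z 0 i = z 0 j.
  by apply/eqP; apply/negPn/negP => ij; apply: zC; exists i, j.
suff /eqP : z = 0 by rewrite -enorm_eq0 (eqP z1) oner_eq0.
apply/rowP => i; rewrite mxE; apply/eqP.
move: z0; under eq_bigr do rewrite (zC _ i).
rewrite sumr_const card_ord => /eqP; rewrite mulrn_eq0 => /orP[/eqP n0|//].
by have := ltn_ord i; rewrite [X in (_ < X)%N]n0.
Qed.

Lemma sphere_hyperplane_of (f : 'I_n -> R) i0 j0 : f i0 != f j0 ->
  exists z : sphere (hyperplane R n),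
    forall i j, (val z 0 i <= val z 0 j) = (f i <= f j).
Proof.
(* Subtracting the mean [m] lands in the hyperplane and, like the later normalization, preserves the
   order of the values. *)
move=> f_ij; pose m := n%:R^-1 * \sum_i f i; pose y := \row_i (f i - m).
have n0 : n%:R != 0 :> R by rewrite pnatr_eq0 -lt0n (leq_trans _ (ltn_ord i0)).
have yW : y \in hyperplane R n.
  rewrite mem_hyperplane; under eq_bigr do rewrite mxE.
  by rewrite sumrB sumr_const card_ord -mulr_natl mulVKf // subrr.
have y0 : y != 0.
  apply: contraNneq f_ij => y0; apply/eqP/(addIr (- m)).
  by have /rowP yE := y0; have := yE i0; have := yE j0; rewrite !mxE => -> ->.
exists (normalize yW y0) => i j /=; rewrite !mxE.
by rewrite ler_pM2l ?invr_gt0 ?enorm_gt0 // lerD2r.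
Qed.

Lemma in_closed_hemisphere_A (E : {set opair n}) :
  in_closed_hemisphere (@A R n) E <->
  exists2 f : 'I_n -> R, (exists i j, f i != f j) &
    forall i j, arc E i j -> f i <= f j.
Proof.
split=> [[z zE]|[f [i0 [j0 f_ij]] fE]].
  exists (val z 0) => [|i j /arcP[p pE pij]].
    exact: sphere_hyperplane_nonconstant.
  by have := zE p pE; rewrite dot_A_ge0 pij.
have [z zf] := sphere_hyperplane_of f_ij; exists z => p pE.
by rewrite dot_A_ge0 zf fE ?arc_val.
Qed.

Lemma in_open_hemisphere_A (E : {set opair n}) :
  in_open_hemisphere (@A R n) E <->
  exists2 f : 'I_n -> R, (exists i j, f i != f j) &
    forall i j, arc E i j -> f i < f j.
Proof.
split=> [[z zE]|[f [i0 [j0 f_ij]] fE]].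
  exists (val z 0) => [|i j /arcP[p pE pij]].
    exact: sphere_hyperplane_nonconstant.
  by have := zE p pE; rewrite dot_A_gt0 pij.
have [z zf] := sphere_hyperplane_of f_ij; exists z => p pE.
(* The strict order is the negation of the reversed weak one, so [zf] transfers it too. *)
by rewrite dot_A_gt0 ltNge zf -ltNge fE ?arc_val.
Qed.

Lemma acyclic_in_open_hemisphere (E : {set opair n}) : (1 < n)%N ->
  acyclic E <-> in_open_hemisphere (@A R n) E.
Proof.
move=> n1; rewrite in_open_hemisphere_A; split=> [aE|[f _ fE]]; last first.
  exact: increasing_acyclic fE.
(* The ancestor count may be constant when there are no arcs. *)
have [E0|[p pE]] := set_0Vmem E.
  exists (fun i => i%:R) => [|i j /arcP[p]]; last by rewrite E0 inE.
  (* The bound [1 < n] provides the distinct vertices 0 and 1. *)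
  exists (Ordinal (ltnW n1)), (Ordinal n1).
  by rewrite eqr_nat.
exists (fun i => #|ancestors E i|%:R) => [|i j ij].
  exists (val p).1, (val p).2.
  by rewrite eqr_nat neq_ltn ltn_card_ancestors ?arc_val.
by rewrite ltr_nat ltn_card_ancestors.
Qed.

Lemma disconnected_in_closed_hemisphere (E : {set opair n}) :
  ~ strongly_connected E <-> in_closed_hemisphere (@A R n) E.
Proof.
rewrite in_closed_hemisphere_A; split=> [|[f [i [j /negP f_ij]] fE] scE].
  move=> /existsNP[i /existsNP[j /negP ij]].
  exists (fun k => (connect (arc E) i k)%:R) => [|k l kl].
    by exists i, j; rewrite connect0 (negPf ij) oner_eq0.
  rewrite ler_nat; case: (boolP (connect _ i k)) => // ik.
  by rewrite (connect_trans ik (connect1 kl)).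
(* Paths in both directions between [i] and [j] force [f i = f j]. *)
by apply: f_ij; rewrite eq_le !(nondecreasing_connect fE).
Qed.

End Hemispheres.

Theorem proposition1 (R : realType) (n : nat) (hn : (2 <= n)%N) :
  DAG n = Stel (@A R n) /\ DisDS n = BStel (@A R n).
Proof.
split; apply: scomplex_eq => E.
  exact: acyclic_in_open_hemisphere.
exact: disconnected_in_closed_hemisphere.
Qed.
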